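(* Let $\mathcal{A}$ be a finite set of actions, let $r_{\mathrm{true}}:\mathcal{A}\to\mathbb{R}$ be the true reward, and let $\pi_{\mathrm{ref}}$ be a probability distribution on $\mathcal{A}$ (the reference policy). Assume that there exist at least two actions $a_1,a_2\in\mathcal{A}$ with $r_{\mathrm{true}}(a_1)\neq r_{\mathrm{true}}(a_2)$, and that $\pi_{\mathrm{ref}}(a)>0$ for all $a\in\mathcal{A}$. Let $\beta>0$ and let $r:\mathcal{A}\to\mathbb{R}$ be any reward that is rank-preserving with respect to $r_{\mathrm{true}}$. Let $$\pi^*_r=\arg\max_{\pi}\ \mathbb{E}_{a\sim\pi}[r(a)]-\beta\,\mathrm{KL}(\pi,\pi_{\mathrm{ref}}),$$ the maximum being over all probability distributions $\pi$ on $\mathcal{A}$. Then $$\mathbb{E}_{a\sim\pi^*_r}[r_{\mathrm{true}}(a)]>\mathbb{E}_{a\sim\pi_{\mathrm{ref}}}[r_{\mathrm{true}}(a)].$$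
   Context: A policy is a probability distribution on the finite action set $\mathcal{A}\subset\mathbb{R}^d$; $\mathrm{KL}(p,q)=\sum_{a}p(a)\log\frac{p(a)}{q(a)}$ is the Kullback-Leibler divergence. A reward $r:\mathcal{A}\to\mathbb{R}$ is rank-preserving with respect to a reward $r':\mathcal{A}\to\mathbb{R}$ if for all $(a_1,a_2)\in\mathcal{A}\times\mathcal{A}$, $r'(a_1)>r'(a_2)$ implies $r(a_1)>r(a_2)$. The maximizer $\pi^*_r$ exists and is unique. *)

(* Defs.v *)
From mathcomp Require Import all_boot all_order all_algebra.
From mathcomp Require Import all_classical all_reals all_analysis.

Set Implicit Arguments.
Unset Strict Implicit.
Unset Printing Implicit Defensive.

Import Order.TTheory GRing.Theory Num.Theory.

Local Open Scope ring_scope.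

Definition is_policy (R : realType) (A : finType) (p : A -> R) : Prop :=
  (forall a, 0 <= p a) /\ \sum_(a : A) p a = 1.

Definition expect (R : realType) (A : finType) (p f : A -> R) : R :=
  \sum_(a : A) p a * f a.

(* Terms with [p a = 0] vanish, which is the convention 0 log 0 = 0.  This
   real-valued sum is the divergence only when [q a = 0] implies [p a = 0]
   (otherwise the divergence is infinite); it is used here with a reference
   distribution [q] that is positive everywhere. *)
Definition KL (R : realType) (A : finType) (p q : A -> R) : R :=
  \sum_(a : A) p a * ln (p a / q a).

Definition rank_preserving (R : realType) (A : finType) (r r' : A -> R) : Prop :=
  forall a1 a2 : A, r' a1 > r' a2 -> r a1 > r a2.

Definition objective (R : realType) (A : finType) (r piref : A -> R) (beta : R)
    (p : A -> R) : R :=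
  expect p r - beta * KL p piref.

Definition is_maximizer (R : realType) (A : finType) (r piref : A -> R)
    (beta : R) (p : A -> R) : Prop :=
  is_policy p /\
  forall q : A -> R, is_policy q ->
    objective r piref beta q <= objective r piref beta p.

(* Main.v *)
(* The objective equals beta * ln Z - beta * KL(p, g), where
   g(a) = pi_ref(a) * exp(r(a) / beta) / Z is the Gibbs policy, so by the
   equality case of Gibbs' inequality the only maximizer is g.  The gain
   E_g[r_true] - E_ref[r_true] is then 1/Z times the covariance under pi_ref of
   exp(r / beta) and r_true, which are similarly ordered: it is positive by
   Chebyshev's sum inequality. *)

Require Import Defs.
From mathcomp Require Import all_boot all_order all_algebra.
From mathcomp Require Import all_classical all_reals all_analysis.
From mathcomp Require Import ring lra.

Set Implicit Arguments.
Unset Strict Implicit.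
Unset Printing Implicit Defensive.

Import Order.TTheory GRing.Theory Num.Theory.

Local Open Scope ring_scope.

Section Policies.
Context {R : realType}.

(** For [x > 0] this is the strict bound [1 + t < expR t] at [t = ln (y / x)], nonzero as [x != y],
    multiplied by [x]. *)
Lemma mul_ln_div_gt (x y : R) : 0 <= x -> 0 < y -> x != y ->
  x - y < x * ln (x / y).
Proof.
rewrite le_eqVlt => /predU1P[<-|x0] y0 xy; first by rewrite mul0r; lra.
have yx0 : 0 < y / x by exact: divr_gt0.
have ln_neq0 : ln (y / x) != 0.
  rewrite ln_eq0//; apply: contra_neq xy => yx1.
  by rewrite -[RHS](divfK (lt0r_neq0 x0)) yx1 mul1r.
have := expR_gt1Dx ln_neq0; rewrite lnK// => lt_ln.
have -> : ln (x / y) = - ln (y / x) by rewrite -lnV// invf_div.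
have : x * (1 + ln (y / x)) < x * (y / x) by rewrite ltr_pM2l.
by rewrite [x * (y / x)]mulrC divfK ?lt0r_neq0//; lra.
Qed.

Lemma mul_ln_div_ge (x y : R) : 0 <= x -> 0 < y -> x - y <= x * ln (x / y).
Proof.
move=> x0 y0; have [->|xy] := eqVneq x y.
  by rewrite divff ?lt0r_neq0// ln1; lra.
exact/ltW/mul_ln_div_gt.
Qed.

Context {A : finType}.
Implicit Types p q f g : A -> R.

Lemma KL_self q : (forall a, 0 < q a) -> KL q q = 0.
Proof. by move=> q0; apply: big1 => a _; rewrite divff ?lt0r_neq0// ln1 mulr0. Qed.

(** Both masses are 1, so subtracting [p b - q b] from each term leaves the sum unchanged and makes
    every term nonnegative. A zero sum then kills each term, and strictness off the diagonal forces
    equality. *)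
Lemma KL_le0_eq p q : is_policy p -> is_policy q -> (forall a, 0 < q a) ->
  KL p q <= 0 -> p =1 q.
Proof.
move=> [p0 p1] [_ q1] q0 KL0 a.
have gap0 b : true -> 0 <= p b * ln (p b / q b) - (p b - q b).
  by move=> _; rewrite subr_ge0 mul_ln_div_ge.
have sum_gap : \sum_b (p b * ln (p b / q b) - (p b - q b)) = KL p q.
  by rewrite sumrB sumrB p1 q1 subrr subr0.
have KLge0 : 0 <= KL p q by rewrite -sum_gap sumr_ge0.
have /eqP := sum_gap; rewrite (_ : KL p q = 0); last by lra.
rewrite psumr_eq0// => /allP/(_ a (mem_index_enum a))/eqP gap_a.
by apply/eqP/negPn/negP => /(mul_ln_div_gt (p0 a) (q0 a)); lra.
Qed.

(** Twice the covariance is the double sum of [p a * p b * ((f a - f b) * (g a - g b))], whose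
    [(a1, a2)] term is positive. *)
Lemma expect_mul_gt p f g a1 a2 : is_policy p -> (forall a, 0 < p a) ->
  (forall a b, 0 <= (f a - f b) * (g a - g b)) ->
  0 < (f a1 - f a2) * (g a1 - g a2) ->
  expect p f * expect p g < expect p (fun a => f a * g a).
Proof.
move=> [_ p1] p0 fg fg12.
have covE : \sum_a \sum_b p a * p b * ((f a - f b) * (g a - g b)) =
    2 * (expect p (fun a => f a * g a) - expect p f * expect p g).
  (* Keeping the factor [\sum_b p b] makes all four terms sums over [b], so the expansion can be
     checked termwise. *)
  transitivity (\sum_a (p a * (f a * g a) * (\sum_b p b)
      - p a * f a * expect p g - p a * g a * expect p f
      + p a * expect p (fun b => f b * g b))).
    apply: eq_bigr => a _; rewrite /expect !mulr_sumr -!sumrB -big_split /=.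
    by apply: eq_bigr => b _; ring.
  rewrite p1 big_split !sumrB /= -!mulr_suml p1 -!/(expect _ _); ring.
have ge0 a b : 0 <= p a * p b * ((f a - f b) * (g a - g b)).
  by rewrite mulr_ge0// mulr_ge0// ltW.
have : 0 < \sum_a \sum_b p a * p b * ((f a - f b) * (g a - g b)).
  rewrite (bigD1 a1)//= ltr_wpDr//.
    by apply: sumr_ge0 => a _; apply: sumr_ge0 => b _.
  rewrite (bigD1 a2)//= ltr_wpDr//; first by apply: sumr_ge0 => b _.
  by rewrite mulr_gt0// mulr_gt0.
by rewrite covE; lra.
Qed.

End Policies.

Section Gibbs.
Context {R : realType} {A : finType}.
Variables (q r : A -> R) (beta : R).
Hypotheses (q_policy : is_policy q) (q_gt0 : forall a, 0 < q a).
Hypothesis beta_gt0 : 0 < beta.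

Let weight a := expR (r a / beta).
Let Z := expect q weight.
Let gibbs a := q a * weight a / Z.

(** If this sum of nonnegative terms were zero, every [q a] would vanish, against total mass 1. *)
Lemma partition_gt0 : 0 < Z.
Proof.
have [q0 q1] := q_policy.
have ge0 a : true -> 0 <= q a * weight a by rewrite mulr_ge0// expR_ge0.
rewrite lt_neqAle sumr_ge0// andbT eq_sym psumr_eq0//; apply/negP => /allP all0.
have : \sum_a q a = 0.
  apply: big1 => a _; have := all0 a (mem_index_enum a).
  by rewrite /= mulf_eq0 (gt_eqF (expR_gt0 _)) orbF => /eqP.
by rewrite q1 => /eqP; rewrite oner_eq0.
Qed.

Lemma gibbs_gt0 a : 0 < gibbs a.
Proof. by rewrite divr_gt0 ?partition_gt0// mulr_gt0// expR_gt0. Qed.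

Lemma gibbs_policy : is_policy gibbs.
Proof.
split=> [a|]; first exact/ltW/gibbs_gt0.
by rewrite -mulr_suml divff// lt0r_neq0// partition_gt0.
Qed.

(** With [ln Z] written as its [p]-average, the identity holds termwise: [ln (p a / gibbs a)] is
    [ln (p a / q a) - r a / beta + ln Z] when [p a > 0]. *)
Lemma objective_gibbs p : is_policy p ->
  objective r q beta p = beta * (ln Z - KL p gibbs).
Proof.
move=> [p0 p1]; have Z0 := partition_gt0.
rewrite /objective /expect /KL -[ln Z]mul1r -p1 mulr_suml -sumrB !mulr_sumr.
rewrite -sumrB; apply: eq_bigr => a _.
have := p0 a; rewrite le_eqVlt => /predU1P[<-|pa0]; first by rewrite !mul0r; ring.
have -> : p a / gibbs a = p a / q a * (expR (- (r a / beta)) * Z).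
  rewrite /gibbs expRN -/(weight a).
  by field; rewrite !lt0r_neq0// expR_gt0.
rewrite !lnM ?posrE ?mulr_gt0 ?invr_gt0 ?expR_gt0// expRK.
by field; rewrite lt0r_neq0.
Qed.

(** Taking [gibbs] itself as competitor gives [KL p gibbs <= KL gibbs gibbs = 0]. *)
Lemma maximizer_gibbs p : is_maximizer r q beta p -> p =1 gibbs.
Proof.
move=> [p_policy p_max]; apply: (KL_le0_eq p_policy gibbs_policy gibbs_gt0).
have := p_max _ gibbs_policy; rewrite !objective_gibbs//; last exact: gibbs_policy.
by rewrite ler_pM2l// (KL_self gibbs_gt0); lra.
Qed.

Lemma expect_gibbs f :
  expect gibbs f = expect q (fun a => weight a * f a) / Z.
Proof.
by rewrite /expect mulr_suml; apply: eq_bigr => a _; rewrite /gibbs; ring.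
Qed.

End Gibbs.

Theorem theorem1 (R : realType) (A : finType) (r_true : A -> R)
    (pi_ref : A -> R) (pi_ref_policy : is_policy pi_ref)
    (r_true_nonconst : exists a1 a2 : A, r_true a1 <> r_true a2)
    (pi_ref_gt0 : forall a : A, 0 < pi_ref a)
    (beta : R) (beta_gt0 : 0 < beta)
    (r : A -> R) (r_rank : rank_preserving r r_true)
    (pi_star : A -> R) (pi_star_max : is_maximizer r pi_ref beta pi_star) :
  expect pi_star r_true > expect pi_ref r_true.
Proof.
have /funext-> := maximizer_gibbs pi_ref_policy pi_ref_gt0 beta_gt0 pi_star_max.
(* The normalizer is itself the expectation of the weight, so clearing it leaves a product of two
   expectations, as in [expect_mul_gt]. *)
rewrite expect_gibbs ltr_pdivlMr ?partition_gt0// mulrC.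
have weight_lt a b : r_true a < r_true b ->
    expR (r a / beta) < expR (r b / beta).
  by move=> /r_rank rab; rewrite ltr_expR ltr_pM2r// invr_gt0.
have ordered a b : r_true a != r_true b ->
    0 < (expR (r a / beta) - expR (r b / beta)) * (r_true a - r_true b).
  rewrite neq_lt => /orP[] lt_ab.
    by rewrite -mulrNN mulr_gt0// opprB subr_gt0// weight_lt.
  by rewrite mulr_gt0// subr_gt0// weight_lt.
have [a1 [a2 /eqP neq12]] := r_true_nonconst.
apply: (expect_mul_gt (a1 := a1) (a2 := a2)) => // [a b|]; last exact: ordered.
(* Rank preservation does not order [r] on ties of [r_true], but there the second factor is zero. *)
by have [->|/ordered/ltW//] := eqVneq (r_true a) (r_true b); rewrite subrr mulr0.
Qed.
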